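(* The Pieri support graph $\mathcal G_N$ and the adjacent-transfer graph $\mathcal G_N^{\rm tr}$, both regarded as graphs on $S_N$, have the same connected components.
   Context: For $\pi\in S_N$ (one-line notation) the Lehmer code is $L(\pi)=(L(\pi)_1,\dots,L(\pi)_N)$, $L(\pi)_i=\#\{j>i:\pi_i>\pi_j\}$. It gives a bijection from $S_N$ to staircase codes $c=(c_1,\dots,c_N)$, $0\le c_i\le C_i:=N-i$. $\mathfrak S_\sigma(x)$ is the classical Schubert polynomial and $[x^a]$ denotes the coefficient of $x^a$. $\mathcal G_N$ is the undirected graph on $S_N$ in which distinct $\pi,\sigma$ are adjacent when $[x^{L(\pi)}]\mathfrak S_\sigma(x)>0$ or $[x^{L(\sigma)}]\mathfrak S_\pi(x)>0$. $\mathcal G_N^{\rm tr}$ is the undirected graph on staircase codes (hence, via the Lehmer-code bijection, on $S_N$) whose edges are $$c\longleftrightarrow c-\mathbf e_i+\mathbf e_{i+1}\quad\text{whenever}\quad0<c_i<C_i\ \text{ and }\ c_{i+1}<C_{i+1},$$ where $\mathbf e_i$ is the $i$th standard basis vector. *)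

(* Defs.v *)
From HB Require Import structures.
From mathcomp Require Import all_boot all_order all_algebra all_fingroup.
From mathcomp Require Import mpoly zify ring.

Set Implicit Arguments.
Unset Strict Implicit.
Unset Printing Implicit Defensive.

Import Order.TTheory GRing.Theory Num.Theory.

Local Open Scope ring_scope.

(* Positions, values and variables are 0-based: they range over 'I_N. *)

Definition lehmer (N : nat) (p : 'S_N) : 'X_{1..N} :=
  [multinom #|[set j : 'I_N | (i < j)%N && (p j < p i)%N]| | i < N].

Lemma ddiff_subproof (N : nat) (i j : 'I_N) (f : {mpoly int[N]}) :
  exists g : {mpoly int[N]}, ('X_i - 'X_j) * g == f - msym (tperm i j) f.
Proof.
pose P (h : {mpoly int[N]}) := exists g : {mpoly int[N]},
  ('X_i - 'X_j) * g = h - msym (tperm i j) h.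
suff [g gE] : P f by exists g; apply/eqP.
have PC c : P c%:MP.
  by exists 0; rewrite mulr0 -alg_mpolyC msymZ msym1 subrr.
have PD h1 h2 : P h1 -> P h2 -> P (h1 + h2).
  by move=> [g1 e1] [g2 e2]; exists (g1 + g2); rewrite mulrDr e1 e2 msymD opprD addrACA.
have PM h1 h2 : P h1 -> P h2 -> P (h1 * h2).
  move=> [g1 e1] [g2 e2]; exists (g1 * h2 + msym (tperm i j) h1 * g2).
  by rewrite mulrDr mulrA e1 mulrCA e2 msymM mulrBl mulrBr addrA subrK.
have PX k : P 'X_k.
  rewrite /P /msym mmapX mmap1U.
  case: tpermP => [->|->|_ _]; first by exists 1; rewrite mulr1.
    by exists (-1); rewrite mulrN1 opprB.
  by exists 0; rewrite mulr0 subrr.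
elim/mpolyind: f => [|c m h _ _ Ph]; first by rewrite -[0]mpolyC0; exact: (PC).
apply: PD => //; rewrite -mul_mpolyC; apply: (PM) => //.
rewrite mpolyXE_id; apply: (big_ind P) => [|h1 h2|k _].
- by rewrite -mpolyC1; exact: (PC).
- exact: (PM).
- elim: (m k) => [|n IHn]; first by rewrite expr0 -mpolyC1; exact: (PC).
  by rewrite exprS; apply: (PM).
Qed.

(* Newton divided difference (f - s_{ij} f) / (x_i - x_j). *)
Definition ddiff (N : nat) (i j : 'I_N) (f : {mpoly int[N]}) :
    {mpoly int[N]} :=
  xchoose (ddiff_subproof i j f).

Lemma ddiffP (N : nat) (i j : 'I_N) (f : {mpoly int[N]}) :
  ('X_i - 'X_j) * ddiff i j f = f - msym (tperm i j) f.
Proof. exact/eqP/(xchooseP (ddiff_subproof i j f)). Qed.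

Definition is_ascent (N : nat) (w : 'S_N) (ij : 'I_N * 'I_N) : bool :=
  (ij.2 == ij.1.+1 :> nat) && (w ij.1 < w ij.2)%N.

(* Number of noninversions of w, i.e. the length of w^-1 w_0. *)
Definition coinv (N : nat) (w : 'S_N) : nat :=
  #|[set ij : 'I_N * 'I_N | (ij.1 < ij.2)%N && (w ij.1 < w ij.2)%N]|.

Fixpoint schubert_rec (N k : nat) (w : 'S_N) : {mpoly int[N]} :=
  if k is k'.+1 then
    if [pick ij | is_ascent w ij] is Some ij then
      ddiff ij.1 ij.2 (schubert_rec k' (tperm ij.1 ij.2 * w)%g)
    else 'X_[[multinom (N - i.+1)%N | i < N]]
  else 'X_[[multinom (N - i.+1)%N | i < N]].

(* S_w = dd_{w^-1 w_0} x^(N-1, ..., 1, 0), along one particular reduced word.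
   Lemmas schubert_w0 and schubert_ascent below show that S_w satisfies
   the full recursion and hence does not depend on the ascents picked; note that
   (s * w) x = w (s x) in mathcomp, so tperm i j * w swaps positions i and j. *)
Definition schubert (N : nat) (w : 'S_N) : {mpoly int[N]} :=
  schubert_rec (coinv w) w.

Lemma coinv_ascent (N : nat) (w : 'S_N) (i j : 'I_N) :
  is_ascent w (i, j) -> coinv w = (coinv (tperm i j * w)%g).+1.
Proof.
case/andP=> /= /eqP ji wij; rewrite /coinv.
set B := [set ij | _ & (_ < (tperm i j * w)%g _)%N].
pose f (p : 'I_N * 'I_N) := (tperm i j p.1, tperm i j p.2).
have fK : involutive f by move=> [a b]; rewrite /f /= !tpermK.
suff -> : [set ij : 'I_N * 'I_N | (ij.1 < ij.2)%N && (w ij.1 < w ij.2)%N]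
        = (i, j) |: f @^-1: B.
  rewrite cardsU1 on_card_preimset ?inE /= ?tpermL ?tpermR ?ji ?ltnNge ?leqnSn //.
  by exists f => ? _; apply: fK.
have aux (a : 'I_N) : a != i -> a != j ->
    ((i < a)%N = (j < a)%N) * ((a < i)%N = (a < j)%N).
  by rewrite -!val_eqE /= ji => ? ?; split; lia.
apply/setP=> [[a b]]; rewrite !inE /= !permM !tpermK xpair_eqE.
have ij : i != j by rewrite -val_eqE /= ji; lia.
have [ltij ltji] : (i < j)%N /\ (j < i)%N = false by rewrite ji; lia.
have nwji : (w j < w i)%N = false by lia.
have ji' : (j == i) = false by rewrite eq_sym (negPf ij).
case: (tpermP i j a) => [->|->|/eqP ai /eqP aj];
  case: (tpermP i j b) => [->|->|/eqP bi /eqP bj];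
  rewrite ?eqxx ?(negPf ij) ?ji' ?ltij ?ltji ?wij ?nwji ?ltnn ?andbF //=;
  try (have [e1 e2] := aux _ ai aj); try (have [e3 e4] := aux _ bi bj).
- by rewrite e3 (negPf bj).
- by rewrite e3.
- by rewrite e2.
- by rewrite e2 (negPf ai).
- by rewrite (negPf ai).
Qed.

Lemma msymXi (N : nat) (s : 'S_N) (k : 'I_N) :
  msym s ('X_k : {mpoly int[N]}) = 'X_(s k).
Proof. by rewrite /msym mmapX mmap1U. Qed.

Lemma subX_neq0 (N : nat) (i j : 'I_N) :
  i != j -> 'X_i - 'X_j != 0 :> {mpoly int[N]}.
Proof.
move=> ij; apply/eqP => /(congr1 (mcoeff U_(i)%MM)).
rewrite mcoeffB !mcoeffX mcoeff0 eqxx; case: eqP => [/mnmP/(_ i)|_]; last by rewrite subr0.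
by rewrite !mnm1E eqxx eq_sym (negPf ij).
Qed.

Lemma alg21 (R : comNzRingType) (x y z u v w : R) :
  y * u = w - v -> x * y * z * u = z * (x * w) - x * (z * v).
Proof. by move=> e; have -> : x * y * z * u = x * z * (y * u); [ring | rewrite e; ring]. Qed.

Lemma alg12 (R : comNzRingType) (x y z u v w : R) :
  x * u = w - v -> x * y * z * u = z * (y * w) - y * (z * v).
Proof. by move=> e; have -> : x * y * z * u = y * z * (x * u); [ring | rewrite e; ring]. Qed.

Lemma ddiffC (N : nat) (i j k l : 'I_N) (f : {mpoly int[N]}) : i != j -> k != l ->
  i != k -> i != l -> j != k -> j != l ->
  ddiff i j (ddiff k l f) = ddiff k l (ddiff i j f).
Proof.
move=> ij kl ik il jk jl.
have key i0 j0 k0 l0 : i0 != k0 -> i0 != l0 -> j0 != k0 -> j0 != l0 ->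
  ('X_k0 - 'X_l0) * (('X_i0 - 'X_j0) * ddiff i0 j0 (ddiff k0 l0 f)) =
  (f - msym (tperm k0 l0) f) - (msym (tperm i0 j0) f
     - msym (tperm i0 j0) (msym (tperm k0 l0) f)).
  move=> *; rewrite ddiffP mulrBr ddiffP; congr (_ - _).
  rewrite -msymB -ddiffP msymM msymB !msymXi !tpermD //.
have x0 := subX_neq0 ij; have y0 := subX_neq0 kl.
have ki : k != i by rewrite eq_sym.
have li : l != i by rewrite eq_sym.
have kj : k != j by rewrite eq_sym.
have lj : l != j by rewrite eq_sym.
apply: (mulfI x0); apply: (mulfI y0).
apply: etrans (key i j k l ik il jk jl) _; apply: esym.
apply: etrans (mulrCA _ _ _) _; apply: etrans (key k l i j ki kj li lj) _.
have -> : msym (tperm i j) (msym (tperm k l) f) = msym (tperm k l) (msym (tperm i j) f).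
  rewrite -!msymMm; congr (msym _ f); apply/permP=> u; rewrite !permM.
  case: (tpermP i j u) => [->|->|/eqP ui /eqP uj].
  - by rewrite !(tpermL, @tpermD _ k l) // eq_sym.
  - by rewrite !(tpermR, @tpermD _ k l) // eq_sym.
  - case: (tpermP k l u) => *; subst; rewrite ?tpermL ?tpermR tpermD //; by rewrite eq_sym.
by ring.
Qed.

Lemma ddiff_braid (N : nat) (a b c : 'I_N) (f : {mpoly int[N]}) : a != b -> b != c -> a != c ->
  ddiff a b (ddiff b c (ddiff a b f)) = ddiff b c (ddiff a b (ddiff b c f)).
Proof.
move=> ab bc ac.
have ba : b != a by rewrite eq_sym.
have cb : c != b by rewrite eq_sym.
have ca : c != a by rewrite eq_sym.
pose x : {mpoly int[N]} := 'X_a - 'X_b; pose y : {mpoly int[N]} := 'X_b - 'X_c.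
pose z : {mpoly int[N]} := 'X_a - 'X_c.
pose s1 := @msym N int (tperm a b); pose s2 := @msym N int (tperm b c).
have x0 : x != 0 := subX_neq0 ab.
have y0 : y != 0 := subX_neq0 bc.
have z0 : z != 0 := subX_neq0 ac.
have s1x : s1 x = - x by rewrite /s1 msymB !msymXi tpermL tpermR opprB.
have s1y : s1 y = z by rewrite /s1 msymB !msymXi tpermR tpermD.
have s1z : s1 z = y by rewrite /s1 msymB !msymXi tpermL tpermD.
have s2x : s2 x = z by rewrite /s2 msymB !msymXi tpermL tpermD.
have s2y : s2 y = - y by rewrite /s2 msymB !msymXi tpermL tpermR opprB.
have s2z : s2 z = x by rewrite /s2 msymB !msymXi tpermR tpermD.
have P1 h : x * ddiff a b h = h - s1 h := ddiffP a b h.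
have P2 h : y * ddiff b c h = h - s2 h := ddiffP b c h.
have s1M u v : s1 (u * v) = s1 u * s1 v by exact: msymM.
have s2M u v : s2 (u * v) = s2 u * s2 v by exact: msymM.
have s1B u v : s1 (u - v) = s1 u - s1 v by exact: msymB.
have s2B u v : s2 (u - v) = s2 u - s2 v by exact: msymB.
have s11 h : s1 (s1 h) = h by rewrite /s1 -msymMm tperm2 msym1m.
have s22 h : s2 (s2 h) = h by rewrite /s2 -msymMm tperm2 msym1m.
have s121 : s1 (s2 (s1 f)) = s2 (s1 (s2 f)).
  rewrite /s1 /s2 -!msymMm; congr (msym _ f).
  have T1 : (tperm a b * (tperm b c * tperm a b))%g = tperm a c.
    by rewrite -{1}(tpermV a b) -conjgE tpermJ tpermR tpermD.
  have T2 : (tperm b c * (tperm a b * tperm b c))%g = tperm a c.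
    by rewrite -{1}(tpermV b c) -conjgE tpermJ tpermL tpermD.
  by rewrite ?mulgA -!mulgA T1 T2.
have zE : z = x + y by rewrite /z /x /y; ring.
clearbody s1 s2 x y z.
have E21 : x * y * z * ddiff b c (ddiff a b f)
    = z * (f - s1 f) - x * (s2 f - s2 (s1 f)).
  transitivity (z * (x * ddiff a b f) - x * (s2 (x * ddiff a b f))).
    by rewrite s2M s2x; apply: alg21; apply: P2.
  by rewrite P1 s2B.
have E12 : x * y * z * ddiff a b (ddiff b c f)
    = z * (f - s2 f) - y * (s1 f - s1 (s2 f)).
  transitivity (z * (y * ddiff b c f) - y * (s1 (y * ddiff b c f))).
    by rewrite s1M s1y; apply: alg12; apply: P1.
  by rewrite P2 s1B.
have V0 : x * y * z != 0 by rewrite !mulf_neq0.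
apply: (mulfI (mulf_neq0 V0 (mulf_neq0 x0 y0))).
transitivity (x * y * (f - s1 f - s2 f + s1 (s2 f) + s2 (s1 f) - s1 (s2 (s1 f)))).
  have -> : forall u, x * y * z * (x * y) * u = y * ((x * y * z) * (x * u)) by move=> u; ring.
  rewrite P1.
  have -> : x * y * z * (ddiff b c (ddiff a b f) - s1 (ddiff b c (ddiff a b f)))
    = x * y * z * ddiff b c (ddiff a b f) + s1 (x * y * z * ddiff b c (ddiff a b f)).
    by rewrite !s1M s1x s1y s1z; ring.
  rewrite E21 s1B !s1M !s1B s1x s1z s11 zE; ring.
have -> : forall u, x * y * z * (x * y) * u = x * ((x * y * z) * (y * u)) by move=> u; ring.
rewrite P2.
have -> : x * y * z * (ddiff a b (ddiff b c f) - s2 (ddiff a b (ddiff b c f)))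
  = x * y * z * ddiff a b (ddiff b c f) + s2 (x * y * z * ddiff a b (ddiff b c f)).
  by rewrite !s2M s2x s2y s2z; ring.
rewrite E12 s2B !s2M !s2B s2y s2z s22 s121 zE; ring.
Qed.
Lemma schubert_ascent (N : nat) (w : 'S_N) (i j : 'I_N) :
  is_ascent w (i, j) ->
  schubert w = ddiff i j (schubert (tperm i j * w)%g).
Proof.
move: {2}(coinv w) (leqnn (coinv w)) => k.
elim: k w i j => [|k IHk] w i j wk asc.
  by rewrite (coinv_ascent asc) in wk.
have IH a b : is_ascent w (a, b) -> forall c d,
    is_ascent (tperm a b * w)%g (c, d) -> schubert (tperm a b * w)%g =
    ddiff c d (schubert (tperm c d * (tperm a b * w))%g).
  move=> abw c d; apply: IHk; move: wk; rewrite (coinv_ascent abw); exact.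
have IH2 a b (abw : is_ascent w (a, b)) c d
    (cdw : is_ascent (tperm a b * w)%g (c, d)) e f :
    is_ascent (tperm c d * (tperm a b * w))%g (e, f) ->
    schubert (tperm c d * (tperm a b * w))%g =
    ddiff e f (schubert (tperm e f * (tperm c d * (tperm a b * w)))%g).
  apply: IHk; move: wk; rewrite (coinv_ascent abw) (coinv_ascent cdw) => ?.
  by apply: leq_trans (leqnSn _) _.
have E (u v : 'I_N) : u != v -> (tperm u v * w)%g u = w v by rewrite permM tpermL.
have step : exists2 ab, is_ascent w ab &
    schubert w = ddiff ab.1 ab.2 (schubert (tperm ab.1 ab.2 * w)%g).
  rewrite {1}/schubert; case wn: (coinv w) => [|n]; first by rewrite (coinv_ascent asc) in wn.
  rewrite [schubert_rec _ _]/=.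
  case: pickP => [ab abw|/(_ (i, j))]; last by rewrite asc.
  exists ab => //; case: ab abw => a b abw; rewrite /schubert.
  by have -> : n = coinv (tperm a b * w)%g by apply: succn_inj; rewrite -wn (coinv_ascent abw).
case: step => [[a b] abw ->]; rewrite [LHS]/=.
move: {IHk wk} (@schubert N) IH IH2 => S IH IH2.
have braid (p q r : 'I_N) : is_ascent w (p, q) -> is_ascent w (q, r) ->
    ddiff p q (S (tperm p q * w)%g) = ddiff q r (S (tperm q r * w)%g).
  move=> pqw qrw; have [/= /eqP qp wpq] := andP pqw; have [/= /eqP rq wqr] := andP qrw.
  have pq : p != q by rewrite -val_eqE /= qp; lia.
  have qr : q != r by rewrite -val_eqE /= rq; lia.
  have pr : p != r by rewrite -val_eqE /= rq qp; lia.
  have [qp' rq' rp'] : [/\ q != p, r != q & r != p] by split; rewrite eq_sym.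
  have wpr := ltn_trans wpq wqr.
  have e1 : tperm q r p = p by rewrite tpermD.
  have e2 : tperm p q r = r by rewrite tpermD.
  have A1 : is_ascent (tperm p q * w)%g (q, r).
    by rewrite /is_ascent /= rq eqxx !permM tpermR tpermD.
  have A2 : is_ascent (tperm q r * (tperm p q * w))%g (p, q).
    by rewrite /is_ascent /= qp eqxx !permM e1 !tpermL e2.
  have B1 : is_ascent (tperm q r * w)%g (p, q).
    by rewrite /is_ascent /= qp eqxx !permM tpermL tpermD.
  have B2 : is_ascent (tperm p q * (tperm q r * w))%g (q, r).
    by rewrite /is_ascent /= rq eqxx !permM e2 !tpermR e1.
  have T1 : (tperm p q * (tperm q r * tperm p q))%g = tperm p r.
    by rewrite -{1}(tpermV p q) -conjgE tpermJ tpermR tpermD.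
  have T2 : (tperm q r * (tperm p q * tperm q r))%g = tperm p r.
    by rewrite -{1}(tpermV q r) -conjgE tpermJ tpermL tpermD.
  have T : (tperm p q * (tperm q r * (tperm p q * w)))%g
         = (tperm q r * (tperm p q * (tperm q r * w)))%g.
    transitivity (tperm p r * w)%g; first by rewrite -T1 -!mulgA.
    by rewrite -T2 -!mulgA.
  have L := etrans (IH _ _ pqw _ _ A1) (congr1 (ddiff q r) (IH2 _ _ pqw _ _ A1 _ _ A2)).
  have R := etrans (IH _ _ qrw _ _ B1) (congr1 (ddiff p q) (IH2 _ _ qrw _ _ B1 _ _ B2)).
  apply: etrans (congr1 (ddiff p q) L) _; apply: esym.
  apply: etrans (congr1 (ddiff q r) R) _; apply: esym.
  by move: T; move: (_ * (_ * (_ * w)))%g => v1; move: (_ * (_ * (_ * w)))%g => v2 ->; apply: ddiff_braid.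
have [/= /eqP ji wij] := andP asc; have [/= /eqP ba wab] := andP abw.
have inj (u v : 'I_N) : u = v :> nat -> u = v by exact: val_inj.
have ij : i != j by rewrite -val_eqE /= ji; lia.
have ab : a != b by rewrite -val_eqE /= ba; lia.
case: (eqVneq a i) => [ai|ai].
  have bj : b = j by apply: inj; rewrite ba ji ai.
  by rewrite ai bj.
have bj : b != j by move: ai; rewrite -!val_eqE /= ji ba; lia.
case: (eqVneq b i) => [bi|bi].
  by move: abw asc; rewrite -bi => abw asc; exact: braid.
case: (eqVneq a j) => [aj|aj].
  by apply: esym; move: abw asc; rewrite -aj => abw asc; exact: braid.
have [ia ja ib jb] : [/\ i != a, j != a, i != b & j != b].
  by split; rewrite eq_sym.
have A : is_ascent (tperm a b * w)%g (i, j).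
  by rewrite /is_ascent /= ji eqxx !permM !tpermD.
have B : is_ascent (tperm i j * w)%g (a, b).
  by rewrite /is_ascent /= ba eqxx !permM !tpermD.
have T : (tperm i j * (tperm a b * w) = tperm a b * (tperm i j * w))%g.
  apply/permP=> u; rewrite !permM.
  case: (tpermP a b u) => [->|->|/eqP ua /eqP ub].
  - by rewrite (@tpermD _ i j a) // (@tpermD _ i j b) // tpermL.
  - by rewrite (@tpermD _ i j a) // (@tpermD _ i j b) // tpermR.
  - by case: (tpermP i j u) => *; rewrite tpermD // eq_sym.
apply: etrans (congr1 (ddiff a b) (IH _ _ abw i j A)) _.
apply: esym; apply: etrans (congr1 (ddiff i j) (IH _ _ asc a b B)) _.
rewrite -T; exact: ddiffC.
Qed.

Lemma schubert_w0 (N : nat) :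
  schubert (perm (@rev_ord_inj N)) = 'X_[[multinom (N - i.+1)%N | i < N]].
Proof.
rewrite /schubert; suff -> : coinv (perm (@rev_ord_inj N)) = 0%N by [].
apply/eqP; rewrite cards_eq0; apply/eqP/setP=> [[a b]].
by rewrite !inE /= !permE /=; have := ltn_ord a; have := ltn_ord b; lia.
Qed.

Definition pieri_graph (N : nat) : rel 'S_N := fun p s =>
  (p != s) &&
  ((0 < (schubert s)@_(lehmer p)) || (0 < (schubert p)@_(lehmer s))).

Definition transfer (N : nat) (c d : 'X_{1..N}) : bool :=
  [exists i : 'I_N, exists j : 'I_N,
    [&& j == i.+1 :> nat, (0 < c i < N - i.+1)%N, (c j < N - j.+1)%N
      & d == (c - U_(i) + U_(j))%MM]].

Definition transfer_graph (N : nat) : rel 'S_N := fun p s =>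
  transfer (lehmer p) (lehmer s) || transfer (lehmer s) (lehmer p).

Definition components (T : finType) (e : rel T) : {set {set T}} :=
  [set [set y | connect e x y] | x in T].

(* Main.v *)
Require Import Defs.
From mathcomp Require Import all_boot all_fingroup.
From mathcomp Require Import all_order all_algebra mpoly zify.

(** Both inclusions between the connectivity relations compare the supports of
    Schubert polynomials with the transfer moves on Lehmer codes, which identify
    permutations with staircase codes ([lehmer_inj], [lehmer_surj]). Below, w is
    a permutation with an ascent at the adjacent positions i < j, and v is
    obtained from w by swapping its entries there, so that S_w is the divided
    difference of S_v at (i, j); if the code of w has entries (l, h) at (i, j),
    then l <= h and the code of v is (h + 1, l) there.

    A transfer is a Pieri path. The exponents of S_w satisfy a dominance bound:
    for every k, the degree of S_w in the variables of index at least k is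
    reached at the code of w ([schubert_suffix]). Together with the recursion for
    the coefficients of a divided difference ([ddiff_rec]), this implies that the
    coefficients of S_w at the exponents obtained from the code of w by replacing
    (l, h) by (t, l + h - t), for l <= t <= h, are all equal to that of S_v at
    its own code, namely 1 ([schubert_pair_eq1]). Now consider a transfer from i
    to j with total T at these two positions. Its two ends have an entry at i
    less than the maximum N - 1 - i, that is, at most the maximum H = N - 1 - j
    at j. Hence both of them occur in S_w for the w whose code has
    h = min(T, H) at j and l = T - h at i ([transfer_pieri]).

    A Pieri edge is a transfer path: all the exponents of S_w are connected by
    transfers to the code of w ([schubert_tconn]). Going from S_v to S_w, an
    exponent b of S_v produces exponents whose entries at i and j have a sum one
    less, and whose entry at i is less than its maximum; for given b these are
    connected to one another, since a transfer can be performed between any two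
    neighbours on this line ([tconn_line]). One of the codes on this line is b
    minus a unit at the first position from i on where b is positive. So the
    induction only needs that this removal maps connected codes to connected
    codes. This is checked on one transfer ([tconn_transfer_hit]), after
    extending the removal to the codes which vanish from i on, where a unit is
    taken from the last positive position instead. *)

Set Implicit Arguments.
Unset Strict Implicit.
Unset Printing Implicit Defensive.

Import GRing.Theory.

(** * Lehmer codes *)

(** The staircase codes: c_i <= N - 1 - i at the 0-based position i. *)
Definition staircase (N : nat) (c : 'X_{1..N}) : bool :=
  [forall i : 'I_N, c i <= N - i.+1].

Lemma staircaseP (N : nat) (c : 'X_{1..N}) :
  reflect (forall i : 'I_N, c i <= N - i.+1) (staircase c).
Proof. exact: forallP. Qed.

Lemma card_ord_gt (N : nat) (i : 'I_N) : #|[set j : 'I_N | i < j]| = N - i.+1.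
Proof.
have e : [set j : 'I_N | i < j] = ~: [set j : 'I_N | j < i.+1].
  by apply/setP => j; rewrite !inE ltnS -ltnNge.
have h : #|[set j : 'I_N | j < i.+1]| = i.+1.
  rewrite -sum1dep_card -(big_ord_widen N (fun=> 1)) //.
  by rewrite sum1_card card_ord.
by rewrite e cardsCs setCK card_ord h.
Qed.

Lemma lehmer_staircase (N : nat) (w : 'S_N) : staircase (lehmer w).
Proof.
apply/staircaseP => i; rewrite mnmE -card_ord_gt; apply: subset_leq_card.
by apply/subsetP => j; rewrite !inE => /andP[].
Qed.

Lemma ascent_lt (N : nat) (w : 'S_N) (i j : 'I_N) :
  j = i.+1 :> nat -> ~~ is_ascent w (i, j) -> w j < w i.
Proof.
move=> ji; rewrite /is_ascent /= ji eqxx /= -leqNgt leq_eqVlt.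
by case/orP=> // /eqP /val_inj /perm_inj eji; move: ji; rewrite eji; lia.
Qed.

(** Swapping the two entries of an ascent changes the entries (l, h) of the
    Lehmer code at these positions into (h + 1, l). *)
Lemma lehmer_ascent (N : nat) (w : 'S_N) (i j : 'I_N) :
  is_ascent w (i, j) ->
  [/\ lehmer (tperm i j * w)%g i = (lehmer w j).+1,
      lehmer (tperm i j * w)%g j = lehmer w i &
      forall k, k != i -> k != j -> lehmer (tperm i j * w)%g k = lehmer w k].
Proof.
case/andP=> /= /eqP ji wij.
have tE k l : k != i -> k != j -> (k < tperm i j l) = (k < l).
  rewrite -!val_eqE /= => ki kj.
  by case: tpermP => [->|->|//]; rewrite ji; lia.
have tg (l : 'I_N) : j < l -> tperm i j l = l.
  by move=> jl; rewrite tpermD // -val_eqE /=; lia.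
split.
- rewrite !mnmE permM tpermL.
  have -> : [set l : 'I_N | (i < l) && ((tperm i j * w)%g l < w j)]
      = j |: [set l : 'I_N | (j < l) && (w l < w j)].
    apply/setP => l; rewrite !inE permM.
    case: (eqVneq l j) => [->|lj]; first by rewrite tpermR wij ji ltnS leqnn.
    case: (ltnP j l) => jl; first by rewrite tg // (_ : i < l) //; lia.
    by rewrite (_ : (i < l) = false) //; move: lj; rewrite -val_eqE /=; lia.
  by rewrite cardsU1 inE ltnn.
- rewrite !mnmE permM tpermR.
  congr #|pred_of_set _|; apply/setP => l; rewrite !inE permM.
  case: (ltnP j l) => jl; first by rewrite tg // (_ : i < l) //; lia.
  case: (eqVneq l j) => [->|lj]; last first.
    by rewrite (_ : (i < l) = false) //; move: lj; rewrite -val_eqE /=; lia.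
  by rewrite tpermR ltnn [RHS]andbC ltnNge (ltnW wij).
- move=> k ki kj; rewrite !mnmE permM tpermD 1?eq_sym //.
  rewrite -[RHS](card_imset _ (@perm_inj _ (tperm i j))).
  congr #|pred_of_set _|; apply/setP => l.
  rewrite -[in RHS](tpermK i j l) (mem_imset _ _ (@perm_inj _ (tperm i j))).
  by rewrite !inE permM tE.
Qed.

Lemma is_ascent_lehmer (N : nat) (w : 'S_N) (i j : 'I_N) :
  j = i.+1 :> nat -> is_ascent w (i, j) = (lehmer w i <= lehmer w j).
Proof.
move=> ji; rewrite /is_ascent /= ji eqxx /= !mnmE; apply/idP/idP.
  move=> wij; apply: subset_leq_card; apply/subsetP => l; rewrite !inE.
  case/andP=> il wl; case: (eqVneq l j) => [lj|]; first by rewrite lj in wl; lia.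
  by rewrite -val_eqE /=; lia.
move=> le; rewrite ltnNge; apply/negP => wji.
suff: #|[set l : 'I_N | (j < l) && (w l < w j)]| <
      #|[set l : 'I_N | (i < l) && (w l < w i)]| by rewrite ltnNge le.
apply: proper_card; apply/properP; split.
  by apply/subsetP => l; rewrite !inE; lia.
exists j; rewrite !inE ?ltnn //.
have : w j != w i by rewrite (inj_eq perm_inj) -val_eqE /=; lia.
by rewrite -val_eqE /=; lia.
Qed.

(** Induction from the reversal downwards, by swapping ascents. *)
Lemma perm_ascent_ind (N : nat) (P : 'S_N -> Prop) :
  (forall w, (forall i j, ~~ is_ascent w (i, j)) -> P w) ->
  (forall w i j, is_ascent w (i, j) -> P (tperm i j * w)%g -> P w) ->
  forall w, P w.
Proof.
move=> P0 PS w; move: {2}(coinv w) (erefl (coinv w)) => k.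
elim: k w => [|k IH] w wk; case: (pickP (is_ascent w)) => [[i j] asc|noasc].
- by rewrite (coinv_ascent asc) in wk.
- by apply: P0 => i j; rewrite noasc.
- by apply: (PS _ _ _ asc); apply: IH; move: wk; rewrite (coinv_ascent asc) => -[].
- by apply: P0 => i j; rewrite noasc.
Qed.

(** The code increases strictly to the left across descents, from c_(N-1) = 0,
    so that a final stretch of descents forces the maximal code there. *)
Lemma lehmer_noascent (N : nat) (w : 'S_N) (k : nat) :
  (forall i j : 'I_N, k <= i -> ~~ is_ascent w (i, j)) ->
  forall i : 'I_N, k <= i -> lehmer w i = N - i.+1.
Proof.
move=> na i ki; apply/eqP; rewrite eqn_leq; apply/andP; split.
  by have /staircaseP := lehmer_staircase w; apply.
move: {2}(N - i.+1) (erefl (N - i.+1)) => d; elim: d i ki => [|d IH] i ki di.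
  by rewrite di.
have jN : i.+1 < N by lia.
have := @is_ascent_lehmer N w i (Ordinal jN) (erefl _).
rewrite (negPf (na i _ ki)) => /esym/negbT; rewrite -ltnNge.
by have := IH (Ordinal jN); rewrite /=; lia.
Qed.

Lemma noascent_decr (N : nat) (w : 'S_N) :
  (forall i j, ~~ is_ascent w (i, j)) ->
  forall i j : 'I_N, i < j -> w j < w i.
Proof.
move=> na i j; move: {2}(j - i) (erefl (j - i)) => d.
elim: d j => [|d IH] j dij ij; first by lia.
have jN : j.-1 < N by have := ltn_ord j; lia.
have jj : j = (Ordinal jN).+1 :> nat by rewrite /=; lia.
have := ascent_lt jj (na _ _).
case: (ltnP i (Ordinal jN)) => [ij'|ij'].
  by have := IH _ _ ij'; rewrite /=; lia.
by have -> : Ordinal jN = i by apply: val_inj; move: ij' => /=; lia.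
Qed.

Lemma noascent_rev (N : nat) (w : 'S_N) :
  (forall i j, ~~ is_ascent w (i, j)) -> w = perm (@rev_ord_inj N).
Proof.
move=> na; have dec := noascent_decr na.
have le k (i : 'I_N) : i = k :> nat -> w i + i < N.
  elim: k i => [|k IH] i ik; first by rewrite ik addn0.
  have jN : k < N by have := ltn_ord i; lia.
  have := dec (Ordinal jN) i; have := IH (Ordinal jN); rewrite /= ik; lia.
have ge k (i : 'I_N) : N - i.+1 = k -> N <= (w i + i).+1.
  elim: k i => [|k IH] i ik; first by lia.
  have jN : i.+1 < N by lia.
  have := dec i (Ordinal jN); have := IH (Ordinal jN); rewrite /=; lia.
apply/permP => i; apply: val_inj; rewrite permE /=.
by have := le _ _ (erefl (nat_of_ord i)); have := ge _ i (erefl _); lia.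
Qed.

Lemma schubert_noascent (N : nat) (w : 'S_N) :
  (forall i j, ~~ is_ascent w (i, j)) -> schubert w = 'X_[lehmer w].
Proof.
move=> na; rewrite [in LHS](noascent_rev na) schubert_w0; congr 'X_[_].
by apply/mnmP => i; rewrite mnmE (@lehmer_noascent N w 0).
Qed.

Lemma lehmer_inj (N : nat) : injective (@lehmer N).
Proof.
move=> w; elim/perm_ascent_ind: w => [w na|w i j asc IH] s ws.
  rewrite (noascent_rev na); apply/esym/noascent_rev => i j.
  apply/negP => asc; have /andP[/= /eqP ji _] := asc.
  by move: asc; rewrite is_ascent_lehmer // -ws -is_ascent_lehmer // (negPf (na _ _)).
have /andP[/= /eqP ji _] := asc.
have ascs : is_ascent s (i, j) by rewrite is_ascent_lehmer // -ws -is_ascent_lehmer.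
apply: (mulgI (tperm i j)); apply: IH; apply/mnmP => k.
have [wi wj wk] := lehmer_ascent asc; have [si sj sk] := lehmer_ascent ascs.
case: (eqVneq k i) => [->|ki]; first by rewrite wi si ws.
case: (eqVneq k j) => [->|kj]; first by rewrite wj sj ws.
by rewrite wk ?sk ?ws.
Qed.

(** [set_pair c i j t u] is the exponent c with its entries at i and j replaced
    by t and u. *)
Definition set_pair (N : nat) (c : 'X_{1..N}) (i j : 'I_N) (t u : nat) :
    'X_{1..N} :=
  [multinom if k == i then t else if k == j then u else c k | k < N].

Lemma lehmer_surj (N : nat) (c : 'X_{1..N}) :
  staircase c -> exists w : 'S_N, lehmer w = c.
Proof.
move: {2}(\sum_i (N - c i)) (erefl (\sum_i (N - c i))) => n.
elim/ltn_ind: n c => n IH c cn /staircaseP cs.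
case: (pickP (fun ij : 'I_N * 'I_N =>
    (ij.2 == ij.1.+1 :> nat) && (c ij.1 <= c ij.2))); last first.
  (* A strictly decreasing staircase code is the code of the reversal. *)
  move=> nle; have cE d (i : 'I_N) : N - i.+1 = d -> N - i.+1 <= c i.
    elim: d i => [|d IHd] i di; first by rewrite di.
    have jN : i.+1 < N by lia.
    have := nle (i, Ordinal jN); rewrite /= eqxx /= => /negbT; rewrite -ltnNge.
    by have := IHd (Ordinal jN); rewrite /=; lia.
  exists (perm (@rev_ord_inj N)); apply/mnmP => i.
  rewrite (@lehmer_noascent _ _ 0) //; last first.
    move=> k l _; apply/negP => /andP[/= /eqP lk]; rewrite !permE /=.
    by have := ltn_ord l; lia.
  by have := cE _ i (erefl _); have := cs i; lia.
case=> i j /= /andP[/eqP ji cij].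
have ij : i != j by rewrite -val_eqE /= ji; lia.
(* Otherwise c is obtained by undoing a descent of a permutation of code d. *)
pose d := set_pair c i j (c j).+1 (c i).
have di : d i = (c j).+1 by rewrite mnmE eqxx.
have dj : d j = c i by rewrite mnmE eq_sym (negPf ij) eqxx.
have dk k : k != i -> k != j -> d k = c k.
  by move=> ki kj; rewrite mnmE (negPf ki) (negPf kj).
have [] := IH _ _ d (erefl _).
- rewrite -cn (bigD1 i) // [X in _ < X](bigD1 i) //=.
  rewrite (bigD1 j) 1?eq_sym // [X in _ < _ + X](bigD1 j) 1?eq_sym //=.
  rewrite (eq_bigr (fun k => N - c k)); last by move=> k /andP[ki kj]; rewrite dk.
  by rewrite di dj; have := cs i; have := cs j; have := ltn_ord j; lia.
- apply/staircaseP => k; case: (eqVneq k i) => [->|ki].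
    by rewrite di; have := cs j; have := ltn_ord j; lia.
  case: (eqVneq k j) => [->|kj]; last by rewrite dk.
  by rewrite dj; have := cs j; have := ltn_ord j; lia.
move=> v vd.
have vasc : ~~ is_ascent v (i, j).
  by rewrite is_ascent_lehmer // vd di dj -ltnNge ltnS.
have asc : is_ascent (tperm i j * v)%g (i, j).
  by rewrite /is_ascent /= ji eqxx !permM tpermL tpermR /= (ascent_lt ji).
exists (tperm i j * v)%g.
have := lehmer_ascent asc; rewrite mulgA tperm2 mul1g => -[wi wj wk].
apply/mnmP => k; case: (eqVneq k i) => [->|ki]; first by rewrite -wj vd dj.
case: (eqVneq k j) => [->|kj]; last by rewrite -wk // vd dk.
by apply: succn_inj; rewrite -wi vd di.
Qed.

(** * Coefficients of divided differences *)

Local Notation "p @_ m" := (mcoeff m p) : nat_scope.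

Section SetPair.
Variables (N : nat) (c : 'X_{1..N}) (i j : 'I_N).
Hypothesis ij : i != j.

Lemma set_pairl t u : set_pair c i j t u i = t.
Proof. by rewrite mnmE eqxx. Qed.

Lemma set_pairr t u : set_pair c i j t u j = u.
Proof. by rewrite mnmE eq_sym (negPf ij) eqxx. Qed.

Lemma set_pairN t u k : k != i -> k != j -> set_pair c i j t u k = c k.
Proof. by move=> ki kj; rewrite mnmE (negPf ki) (negPf kj). Qed.

Lemma set_pair_eq (d : 'X_{1..N}) :
  (forall k, k != i -> k != j -> d k = c k) ->
  d = set_pair c i j (d i) (d j).
Proof.
move=> h; apply/mnmP => k; rewrite mnmE.
by case: eqVneq => [->|ki] //; case: eqVneq => [->|kj] //; apply: h.
Qed.

End SetPair.

Lemma mcoeffXM (N : nat) (g : {mpoly int[N]}) (i : 'I_N) (m : 'X_{1..N}) :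
  ('X_i * g)%R@_m = if m i == 0 then 0%R else g@_(m - U_(i))%MM.
Proof.
rewrite mulrC; case: eqP => [mi|/eqP mi].
  apply/memN_msupp_eq0; rewrite (perm_mem (msuppMX _ _)).
  apply/mapP => -[k _ mk]; move: mi; rewrite mk mnmDE mnm1E eqxx; lia.
by rewrite -[m in LHS](@submK _ U_(i)%MM) ?lep1mP // addmC mcoeffMX.
Qed.

(** The defining equation of the divided difference, read on coefficients. *)
Lemma ddiff_rec (N : nat) (f : {mpoly int[N]}) (i j : 'I_N) (c : 'X_{1..N})
    (t u : nat) (ij : i != j) :
  let F t u := f@_(set_pair c i j t u) in
  let G t u := (ddiff i j f)@_(set_pair c i j t u) in
  ((if t is t'.+1 then G t' u else 0) - (if u is u'.+1 then G t u' else 0)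
   = F t u - F u t)%R.
Proof.
move=> F G.
have := congr1 (mcoeff (set_pair c i j t u)) (ddiffP i j f).
rewrite !mcoeffB mulrBl mcoeffB !mcoeffXM mcoeff_sym set_pairl set_pairr //.
have -> : [multinom set_pair c i j t u (tperm i j k) | k < N] = set_pair c i j u t.
  apply/mnmP => k; rewrite [LHS]mnmE.
  case: tpermP => [->|->|/eqP ki /eqP kj].
  - by rewrite set_pairr // set_pairl.
  - by rewrite set_pairr // set_pairl.
  - by rewrite !set_pairN.
have dl t' : (set_pair c i j t'.+1 u - U_(i))%MM = set_pair c i j t' u.
  apply/mnmP => k; rewrite mnmBE mnm1E; case: (eqVneq i k) => [<-|ik].
    by rewrite !set_pairl subn1.
  by rewrite subn0 !mnmE eq_sym (negPf ik).
have dr u' : (set_pair c i j t u'.+1 - U_(j))%MM = set_pair c i j t u'.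
  apply/mnmP => k; rewrite mnmBE mnm1E; case: (eqVneq j k) => [<-|jk].
    by rewrite !set_pairr // subn1.
  by rewrite subn0 !mnmE [k == j]eq_sym (negPf jk).
by move=> <-; case: t dl dr => [|t'] dl dr; case: u dl dr => [|u'] dl dr;
  rewrite /= ?dl ?dr.
Qed.

Lemma ddiff_sym (N : nat) (f : {mpoly int[N]}) (i j : 'I_N) (c : 'X_{1..N})
    (t u : nat) : i != j ->
  (ddiff i j f)@_(set_pair c i j t u) = (ddiff i j f)@_(set_pair c i j u t).
Proof.
move=> ij; have sg : msym (tperm i j) (ddiff i j f) = ddiff i j f.
  apply: (mulfI (subX_neq0 ij)); rewrite ddiffP.
  have <- : msym (tperm i j) ('X_j - 'X_i)%R = ('X_i - 'X_j)%R :> {mpoly int[N]}.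
    by rewrite msymB !msymXi tpermL tpermR.
  rewrite -msymM -opprB mulNr ddiffP opprB msymB -msymMm tperm2 msym1m //.
rewrite -[in LHS]sg mcoeff_sym; congr (_ @_ _).
apply/mnmP => k; rewrite [LHS]mnmE.
case: tpermP => [->|->|/eqP ki /eqP kj].
- by rewrite set_pairr // set_pairl.
- by rewrite set_pairr // set_pairl.
- by rewrite !set_pairN.
Qed.

(** A monomial of the divided difference of f comes from a monomial of f
    by replacing the pair of exponents (a_i, a_j) by a pair of sum one less
    whose entries are both smaller than the maximum of a_i and a_j. *)
Lemma msupp_ddiff (N : nat) (f : {mpoly int[N]}) (i j : 'I_N) (b : 'X_{1..N}) :
  i != j -> b \in msupp (ddiff i j f) ->
  exists a, [/\ a \in msupp f, forall k, k != i -> k != j -> b k = a k,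
    a i + a j = (b i + b j).+1, b i < maxn (a i) (a j) & b j < maxn (a i) (a j)].
Proof.
move=> ij; rewrite mcoeff_msupp.
have bE : b = set_pair b i j (b i) (b j) by apply: set_pair_eq.
rewrite [X in _@_X]bE.
have main t u : t <= u -> (ddiff i j f)@_(set_pair b i j t u) != 0%R ->
    exists x y, [/\ f@_(set_pair b i j x y) != 0%R, x + y = (t + u).+1
                  & u < maxn x y].
  elim: t u => [|t IH] u tu G0.
    have /= e := ddiff_rec f b 0 u.+1 ij.
    have [f0|f0] := eqVneq (f@_(set_pair b i j 0 u.+1)) 0%R; last first.
      by exists 0, u.+1; split => //; lia.
    have [f1|f1] := eqVneq (f@_(set_pair b i j u.+1 0)) 0%R; last first.
      by exists u.+1, 0; split => //; lia.
    by move: e G0; rewrite f0 f1 sub0r subr0 => /eqP; rewrite oppr_eq0 => ->.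
  have /= e := ddiff_rec f b t.+1 u.+1 ij.
  have [f0|f0] := eqVneq (f@_(set_pair b i j t.+1 u.+1)) 0%R; last first.
    by exists t.+1, u.+1; split => //; lia.
  have [f1|f1] := eqVneq (f@_(set_pair b i j u.+1 t.+1)) 0%R; last first.
    by exists u.+1, t.+1; split => //; lia.
  move: e G0; rewrite f0 f1 subr0 => /subr0_eq <- G0.
  have [|x [y [h1 h2 h3]]] := IH u.+1 _ G0; first by lia.
  by exists x, y; split => //; lia.
have [le|lt] := leqP (b i) (b j).
  move/(main _ _ le) => [x [y [h1 h2 h3]]]; exists (set_pair b i j x y).
  rewrite mcoeff_msupp set_pairl set_pairr //; split => //; try lia.
  by move=> k ki kj; rewrite set_pairN.
rewrite ddiff_sym // => /(main _ _ (ltnW lt)) [x [y [h1 h2 h3]]].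
exists (set_pair b i j x y).
rewrite mcoeff_msupp set_pairl set_pairr //; split => //; try lia.
by move=> k ki kj; rewrite set_pairN.
Qed.

(** * Monomials of Schubert polynomials *)

Lemma ascent_neq (N : nat) (w : 'S_N) (i j : 'I_N) : is_ascent w (i, j) -> i != j.
Proof. by case/andP=> /= /eqP ji _; rewrite -val_eqE /= ji; lia. Qed.

Lemma ascent_succ (N : nat) (w : 'S_N) (i j : 'I_N) :
  is_ascent w (i, j) -> j = i.+1 :> nat.
Proof. by case/andP=> /= /eqP. Qed.

Lemma schubert_staircase (N : nat) (w : 'S_N) (a : 'X_{1..N}) :
  a \in msupp (schubert w) -> staircase a.
Proof.
elim/perm_ascent_ind: w a => [w na|w i j asc IH] a.
  by rewrite schubert_noascent // msuppX inE => /eqP ->; apply: lehmer_staircase.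
have ji := ascent_succ asc; have ij := ascent_neq asc.
rewrite (schubert_ascent asc) => /(msupp_ddiff ij) [b [/IH /staircaseP bs bk bij bi bj]].
have := bs i; have := bs j; have := ltn_ord j => ? ? ?.
apply/staircaseP => k; case: (eqVneq k i) => [->|ki]; first by lia.
by case: (eqVneq k j) => [->|kj]; [lia | rewrite bk].
Qed.

Lemma sum_pair (N : nat) (P : pred 'I_N) (a b : 'I_N -> nat) (i j : 'I_N) :
  i != j -> P i -> P j -> (forall k, k != i -> k != j -> a k = b k) ->
  \sum_(k | P k) a k + (b i + b j) = \sum_(k | P k) b k + (a i + a j).
Proof.
move=> ij Pi Pj ab; have ji : j != i by rewrite eq_sym.
rewrite (bigD1 i) // (bigD1 j) ?Pj //= [X in _ = X + _](bigD1 i) //.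
rewrite [X in _ = _ + X + _](bigD1 j) ?Pj //=.
rewrite (eq_bigr b) => [|k /andP[/andP[_ ki] kj]]; last exact: ab.
lia.
Qed.

(** The degree of a monomial of a Schubert polynomial in the variables of index
    at least k is at most that of the Lehmer code. Divided differences in
    positions other than (k - 1, k) change both sides alike; when no such ascent
    is left, the code is maximal at all the positions from k on. *)
Lemma schubert_suffix (N : nat) (w : 'S_N) (k : nat) (a : 'X_{1..N}) :
  a \in msupp (schubert w) ->
  \sum_(l : 'I_N | k <= l) a l <= \sum_(l : 'I_N | k <= l) lehmer w l.
Proof.
move: {2}(coinv w) (erefl (coinv w)) => n.
elim: n w a => [|n IH] w a wn aw;
  case: (pickP (fun ij => is_ascent w ij && (ij.2 != k :> nat)))
    => [[i j] /andP[/= asc jk]|na].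
- by rewrite (coinv_ascent asc) in wn.
- apply: leq_sum => l kl; rewrite (@lehmer_noascent _ w k) //.
    by have /staircaseP := schubert_staircase aw; apply.
  move=> i j ki; apply/negP => asc; have ji := ascent_succ asc.
  by have := na (i, j); rewrite asc /= ji; lia.
- have ji := ascent_succ asc; have ij := ascent_neq asc.
  move: aw; rewrite (schubert_ascent asc).
  move=> /(msupp_ddiff ij) [b [bv bk bij _ _]].
  have [vi vj vk] := lehmer_ascent asc.
  move: wn; rewrite (coinv_ascent asc) => -[wn].
  have le := IH _ _ wn bv.
  have [ki|ik] := leqP k i.
    have kj : k <= j by lia.
    move: le; have := sum_pair (P := fun l : 'I_N => k <= l) ij ki kj bk.
    have := sum_pair (P := fun l : 'I_N => k <= l) ij ki kj vk.
    by rewrite vi vj /=; set A := bigop _ _ _; set B := bigop _ _ _;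
      set C := bigop _ _ _; set D := bigop _ _ _; lia.
  have off (l : 'I_N) : k <= l -> l != i /\ l != j.
    by rewrite -!val_eqE /=; lia.
  rewrite (eq_bigr b) => [|l /off[li lj]]; last exact: bk.
  rewrite [X in _ <= X](eq_bigr (lehmer (tperm i j * w)%g)) //.
  by move=> l /off[li lj]; rewrite vk.
- apply: leq_sum => l kl; rewrite (@lehmer_noascent _ w k) //.
    by have /staircaseP := schubert_staircase aw; apply.
  move=> i j ki; apply/negP => asc; have ji := ascent_succ asc.
  by have := na (i, j); rewrite asc /= ji; lia.
Qed.

Lemma schubert_pair_le (N : nat) (w : 'S_N) (i j : 'I_N) (t u : nat) :
  j = i.+1 :> nat ->
  (schubert w)@_(set_pair (lehmer w) i j t u) != 0%R -> u <= lehmer w j.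
Proof.
move=> ji; rewrite -mcoeff_msupp => /(schubert_suffix j).
have ij : i != j by rewrite -val_eqE /= ji; lia.
rewrite (bigD1 j) //= [X in _ <= X](bigD1 j) //= set_pairr //.
rewrite (eq_bigr (lehmer w)) ?leq_add2r // => k /andP[jk kj].
by rewrite set_pairN // -val_eqE /=; lia.
Qed.

(** If the Lehmer code of w has entries l <= h at the adjacent positions i and
    j, then its Schubert polynomial contains with coefficient 1 all the monomials
    obtained by replacing (l, h) by (t, l + h - t) for l <= t <= h. The first
    hypothesis provides the inductive step of [schubert_lehmer]. *)
Lemma schubert_pair_eq1 (N : nat) (w : 'S_N) (i j : 'I_N) (t u : nat) :
  (schubert (tperm i j * w)%g)@_(lehmer (tperm i j * w)%g) = 1%R ->
  is_ascent w (i, j) -> lehmer w i <= t <= lehmer w j ->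
  t + u = lehmer w i + lehmer w j ->
  (schubert w)@_(set_pair (lehmer w) i j t u) = 1%R.
Proof.
move=> v1 asc; have ij := ascent_neq asc; have ji := ascent_succ asc.
set v := (tperm i j * w)%g in v1; have [vi vj vk] := lehmer_ascent asc.
rewrite -/v in vi vj vk.
have svw x y : set_pair (lehmer v) i j x y = set_pair (lehmer w) i j x y.
  apply/mnmP => k; rewrite [LHS]mnmE [RHS]mnmE.
  by case: eqVneq => // ki; case: eqVneq => // kj; apply: vk.
have F0 x y : lehmer w i < y -> (schubert v)@_(set_pair (lehmer w) i j x y) = 0%R.
  move=> lt; apply: contraTeq lt; rewrite -svw => /(schubert_pair_le ji).
  by rewrite vj -leqNgt.
have lv : lehmer v = set_pair (lehmer w) i j (lehmer w j).+1 (lehmer w i).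
  by rewrite -vi -vj; apply: set_pair_eq.
have G0 x y : lehmer w j < y -> (schubert w)@_(set_pair (lehmer w) i j x y) = 0%R.
  by move=> lt; apply: contraTeq lt => /(schubert_pair_le ji); rewrite -leqNgt.
(* By F0 and G0, the recursion for coefficients only has a source term at t = l,
   so the coefficient stays constant as t increases from there. *)
elim: t u => [|t IH] u /andP[lt th] tu.
  have := ddiff_rec (schubert v) (lehmer w) 0 u.+1 ij.
  rewrite /= -(schubert_ascent asc) F0; last by lia.
  have -> : set_pair (lehmer w) i j u.+1 0 = lehmer v.
    by rewrite lv; congr (set_pair _ _ _ _ _); lia.
  by rewrite v1 !sub0r => /oppr_inj.
have := ddiff_rec (schubert v) (lehmer w) t.+1 u.+1 ij.
rewrite /= -(schubert_ascent asc) F0 1?[X in (_ = X)%R -> _]sub0r; last by lia.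
have [e|ne] := eqVneq (lehmer w i) t.+1.
  rewrite G0 1?sub0r; last by lia.
  have -> : set_pair (lehmer w) i j u.+1 t.+1 = lehmer v.
    by rewrite lv; congr (set_pair _ _ _ _ _); lia.
  by rewrite v1 => /oppr_inj.
rewrite F0; last by lia.
move=> /eqP; rewrite oppr0 subr_eq0 => /eqP <-; apply: IH; lia.
Qed.

Lemma schubert_lehmer (N : nat) (w : 'S_N) : (schubert w)@_(lehmer w) = 1%R.
Proof.
elim/perm_ascent_ind: w => [w na|w i j asc IH].
  by rewrite schubert_noascent // mcoeffX eqxx.
have ji := ascent_succ asc.
rewrite [X in _@_X](@set_pair_eq _ (lehmer w) i j) //.
by apply: schubert_pair_eq1 => //; rewrite leqnn -is_ascent_lehmer.
Qed.

(** * Transfer-connected codes *)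

(** Two codes are connected when they are the Lehmer codes of permutations in
    the same component of the transfer graph; in particular both are staircase
    codes. *)
Definition tconn (N : nat) (c d : 'X_{1..N}) : Prop :=
  exists p s : 'S_N,
    [/\ lehmer p = c, lehmer s = d & connect (@transfer_graph N) p s].

Lemma transfer_connect_sym (N : nat) : connect_sym (@transfer_graph N).
Proof. by apply: sym_connect_sym => p s; rewrite /transfer_graph orbC. Qed.

Section Tconn.
Variable N : nat.
Implicit Types (a b c d : 'X_{1..N}) (i j k l : 'I_N).

Lemma tconn_refl c : staircase c -> tconn c c.
Proof. by move=> /lehmer_surj[p pc]; exists p, p; rewrite pc connect0. Qed.

Lemma tconn_sym c d : tconn c d -> tconn d c.
Proof. by case=> p [s [pc sd ps]]; exists s, p; rewrite transfer_connect_sym. Qed.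

Lemma tconn_trans c d b : tconn c d -> tconn d b -> tconn c b.
Proof.
case=> p [s [pc sd ps]] [p' [s' [pd sb ps']]].
have e : s = p' by apply: lehmer_inj; rewrite sd pd.
by exists p, s'; split => //; apply: connect_trans ps _; rewrite e.
Qed.

Lemma staircaseB c k : staircase c -> staircase (c - U_(k))%MM.
Proof.
move=> /staircaseP cs; apply/staircaseP => l; rewrite mnmBE.
by apply: leq_trans (leq_subr _ _) (cs l).
Qed.

Lemma transferP c d :
  reflect (exists i j, [/\ j = i.+1 :> nat, 0 < c i < N - i.+1,
      c j < N - j.+1 & d = (c - U_(i) + U_(j))%MM])
    (transfer c d).
Proof.
apply: (iffP existsP) => [[i /existsP[j /and4P[/eqP ? ? ? /eqP ?]]]|].
  by exists i, j.
case=> i [j [ji ? ? ->]]; exists i; apply/existsP; exists j.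
by apply/and4P; split=> //; apply/eqP.
Qed.

Lemma tconn_step c i j :
  staircase c -> j = i.+1 :> nat -> 0 < c i < N - i.+1 -> c j < N - j.+1 ->
  tconn c (c - U_(i) + U_(j))%MM.
Proof.
move=> cs ji ci cj; set d := (_ + _)%MM.
have ds : staircase d.
  apply/staircaseP => k; have /staircaseP/(_ k) := cs.
  rewrite mnmDE mnmBE !mnm1E; case: (eqVneq j k) => [<-|_]; first by lia.
  by lia.
have [p pc] := lehmer_surj cs; have [s sd] := lehmer_surj ds.
exists p, s; split => //; apply: connect1; apply/orP; left.
by rewrite pc sd; apply/transferP; exists i, j.
Qed.

Lemma tconn_pair c i j t u n :
  j = i.+1 :> nat -> t + n < N - i.+1 -> u + n <= N - j.+1 ->
  (forall k, k != i -> k != j -> c k <= N - k.+1) ->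
  tconn (set_pair c i j (t + n) u) (set_pair c i j t (u + n)).
Proof.
move=> ji; have ij : i != j by rewrite -val_eqE /= ji; lia.
have st x y : x <= N - i.+1 -> y <= N - j.+1 ->
    (forall k, k != i -> k != j -> c k <= N - k.+1) ->
    staircase (set_pair c i j x y).
  move=> xi yj ck; apply/staircaseP => k; rewrite mnmE.
  by case: eqVneq => [->|ki] //; case: eqVneq => [->|kj] //; apply: ck.
elim: n u => [|n IH] u tn un ck.
  by rewrite !addn0; apply: tconn_refl; apply: st => //; lia.
apply: tconn_trans (_ : tconn _ (set_pair c i j (t + n) u.+1)) _; last first.
  by rewrite addnS -addSn; apply: IH => //; lia.
have -> : set_pair c i j (t + n) u.+1
    = (set_pair c i j (t + n.+1) u - U_(i) + U_(j))%MM.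
  apply/mnmP => k; rewrite mnmDE mnmBE !mnm1E [i == k]eq_sym [j == k]eq_sym.
  case: (eqVneq k i) => [->|ki].
    by rewrite !set_pairl (negPf ij) addnS subn1 addn0.
  case: (eqVneq k j) => [->|kj]; first by rewrite !set_pairr // subn0 addn1.
  by rewrite !set_pairN // subn0 addn0.
by apply: tconn_step => //; rewrite ?set_pairl ?set_pairr //;
  first (apply: st => //); lia.
Qed.

(** Staircase codes which only differ by how two adjacent positions share their
    sum are connected, provided that the first one of these is not maximal. *)
Lemma tconn_line a b i j :
  j = i.+1 :> nat -> staircase a -> staircase b ->
  (forall k, k != i -> k != j -> a k = b k) ->
  a i + a j = b i + b j -> a i < N - i.+1 -> b i < N - i.+1 -> tconn a b.
Proof.
move=> ji; wlog le : a b / b i <= a i.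
  move=> W as_ bs ab s ai bi; case: (leqP (b i) (a i)) => [le|/ltnW le].
    exact: W.
  by apply: tconn_sym; apply: W => // k ki kj; rewrite ab.
move=> /staircaseP as_ /staircaseP bs ab s ai bi.
have := @tconn_pair a i j (b i) (a j) (a i - b i) ji.
rewrite subnKC // (_ : a j + (a i - b i) = b j); last by lia.
rewrite -(@set_pair_eq _ a i j) // -(@set_pair_eq _ a i j) //.
  by apply => //; exact: bs.
by move=> k ki kj; rewrite ab.
Qed.

(** A unit can be moved from position j to a later position k across zeros. *)
Lemma tconn_slide a j k :
  j < k -> staircase a -> (forall l, j < l < k -> a l = 0) ->
  0 < a j < N - j.+1 -> a k < N - k.+1 -> tconn a (a - U_(j) + U_(k))%MM.
Proof.
move: {2}(k - j) (erefl (k - j)) => n.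
elim: n a j => [|n IH] a j nE jk as_ z aj ak; first by lia.
have [kj|kj] := eqVneq (k : nat) j.+1; first exact: tconn_step.
have qN : j.+1 < N by have := ltn_ord k; lia.
pose q := Ordinal qN; have qE : q = j.+1 :> nat by [].
have aq : a q = 0 by apply: z; lia.
have jq : (j == q) = false by rewrite -val_eqE /= ; lia.
have jk' : (j == k) = false by rewrite -val_eqE /= ; lia.
have qk : (q == k) = false by rewrite -val_eqE /= ; lia.
have c1 : tconn a (a - U_(j) + U_(q))%MM.
  by apply: tconn_step => //; rewrite aq; have := ltn_ord k; lia.
have [p [s [_ sE _]]] := c1; apply: tconn_trans c1 _.
have -> : (a - U_(j) + U_(k) = (a - U_(j) + U_(q)) - U_(q) + U_(k))%MM.
  by rewrite addmK.
apply: IH; rewrite -?sE ?lehmer_staircase ?sE //; try lia.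
- move=> l /andP[ql lk]; rewrite mnmDE mnmBE !mnm1E z; last by lia.
  by rewrite -!val_eqE /=; lia.
- by rewrite mnmDE mnmBE !mnm1E eqxx aq; lia.
- by rewrite mnmDE mnmBE !mnm1E jk' qk; lia.
Qed.

(** * Removing a unit from a code *)

(** [hit i a k] says that k is the first position from i on where a is positive
    or, when there is none, the last position where a is positive. *)
Definition hit i a k : Prop :=
  0 < a k /\
  ((i <= k /\ forall l, i <= l < k -> a l = 0) \/
   (k < i /\ forall l, k < l -> a l = 0)).

Lemma hit_exists i a m : 0 < a m -> exists k, hit i a k.
Proof.
move=> am; case: (pickP (fun l => (i <= l) && (0 < a l))) => [l0 l0P|no].
  case: (@arg_minnP _ l0 (fun l => (i <= l) && (0 < a l)) (fun l => l : nat) l0P)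
    => k /andP[ik ak] kmin.
  exists k; split => //; left; split => // l /andP[il lk].
  apply/eqP; rewrite -leqn0 leqNgt; apply/negP => al.
  by have := kmin l; rewrite il al => /(_ isT); lia.
have z l : i <= l -> a l = 0 by move=> il; have := no l; rewrite il; lia.
case: (@arg_maxnP _ m (fun l => 0 < a l) (fun l => l : nat) am) => k ak kmax.
exists k; split => //; right; split.
  by rewrite ltnNge; apply/negP => /z; lia.
move=> l kl; apply/eqP; rewrite -leqn0 leqNgt; apply/negP => al.
by have := kmax l al; lia.
Qed.

(** Removing a unit at the hit position maps the two ends of a transfer to
    connected codes. *)
Lemma tconn_transfer_hit i a b k k' :
  transfer a b -> staircase a -> hit i a k -> hit i b k' ->
  tconn (a - U_(k))%MM (b - U_(k'))%MM.
Proof.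
move=> /transferP[p [q [qp ap aq bE]]] as_ [ak hk] [bk' hk'].
have pq : p != q by rewrite -val_eqE /= qp; lia.
have bp : b p = (a p).-1.
  by rewrite bE mnmDE mnmBE !mnm1E eqxx [q == p]eq_sym (negPf pq) addn0 subn1.
have bq : b q = (a q).+1.
  by rewrite bE mnmDE mnmBE !mnm1E eqxx (negPf pq) subn0 addn1.
have bN l : l != p -> l != q -> b l = a l.
  move=> lp lq; rewrite bE mnmDE mnmBE !mnm1E.
  by rewrite eq_sym (negPf lp) eq_sym (negPf lq) subn0 addn0.
have val (x y : 'I_N) : x = y :> nat -> x = y by exact: val_inj.
case: (eqVneq k k') => [kk|kk].
  subst k'; have -> : (b - U_(k) = (a - U_(k)) - U_(p) + U_(q))%MM.
    apply/mnmP => l; rewrite bE !(mnmDE, mnmBE) !mnm1E.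
    case: (eqVneq k l) => [kl|]; last by lia.
    subst l; case: (eqVneq p k) => [pk|]; last by lia.
    by subst k; lia.
  apply: tconn_step; rewrite ?staircaseB //.
    rewrite mnmBE mnm1E; case: (eqVneq k p) => [kp|_]; last by rewrite subn0.
    by subst k; lia.
  by rewrite mnmBE; lia.
(* The transfer either moves the hit unit itself, or it makes q positive before
   the position k hit in a. *)
have [[kp k'q]|] : (k = p /\ k' = q) \/
    (k' = q /\ q < k /\ forall l, q <= l < k -> a l = 0).
  have dec l : b l = 0 -> 0 < a l -> l = p.
    move=> bl al; apply/eqP; apply: contraPT bl => lp.
    by case: (eqVneq l q) => [->|lq]; [rewrite bq | rewrite bN //; lia].
  have inc l : a l = 0 -> 0 < b l -> l = q.
    move=> al bl; apply/eqP; apply: contraTT bl => lq.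
    by case: (eqVneq l p) => [e|lp]; [subst l; lia | rewrite bN // al].
  have kk' : (k < k') || (k' < k) by move: kk; rewrite -val_eqE /=; lia.
  case: hk hk' => [[ik zk]|[ki zk]] [[ik' zk']|[ki' zk']].
  - case/orP: kk' => [lt|lt].
      have kp : k = p by apply: dec => //; apply: zk'; lia.
      left; split => //; apply: val; subst k.
      by apply/eqP; apply: contraT => ne; have := zk' q; rewrite bq; lia.
    have k'q : k' = q by apply: inc => //; apply: zk; lia.
    by right; subst k'; do 2!split => //; move=> l ql; apply: zk; lia.
  - have kp : k = p by apply: dec => //; apply: zk'; lia.
    by have := zk' q; rewrite bq; subst k; lia.
  - have k'q : k' = q by apply: inc => //; apply: zk; lia.
    left; split => //; apply: val; subst k'.
    by apply/eqP; apply: contraT => ne; have := zk p; lia.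
  - case/orP: kk' => [lt|lt].
      have k'q : k' = q by apply: inc => //; apply: zk; lia.
      left; split => //; apply: val; subst k'.
      by apply/eqP; apply: contraT => ne; have := zk p; lia.
    have kp : k = p by apply: dec => //; apply: zk'; lia.
    by have := zk' q; rewrite bq; subst k; lia.
  subst k k'; have -> : (b - U_(q) = a - U_(p))%MM by rewrite bE addmK.
  by apply: tconn_refl; apply: staircaseB.
case=> k'q [qk z]; subst k'.
(* The transfer fills a position q before the hit position k of a: the two
   results differ by a unit moved from p to k across zeros. *)
have -> : (b - U_(q) = (a - U_(k)) - U_(p) + U_(k))%MM.
  rewrite bE addmK; apply/mnmP => l; rewrite !(mnmDE, mnmBE) !mnm1E.
  case: (eqVneq k l) => [kl|]; last by lia.
  subst l; have : (p == k) = false by rewrite -val_eqE /=; lia.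
  by move=> ->; lia.
apply: tconn_slide; rewrite ?staircaseB //; try lia.
- move=> l /andP[pl lk]; rewrite mnmBE z //; lia.
- rewrite mnmBE mnm1E; have -> : (k == p) = false by rewrite -val_eqE /=; lia.
  by rewrite subn0.
- rewrite mnmBE mnm1E eqxx; have /staircaseP/(_ k) := as_; lia.
Qed.

Lemma tconn_hit i a b k : tconn a b -> hit i a k ->
  exists k', hit i b k' /\ tconn (a - U_(k))%MM (b - U_(k'))%MM.
Proof.
case=> p [s [<- <- /connectP[r]]]; elim: r p k => [|q r IH] p k /=.
  move=> _ -> hk; exists k; split => //; apply: tconn_refl.
  exact/staircaseB/lehmer_staircase.
case/andP=> pq qr sE hk.
have [m qm] : exists m, 0 < lehmer q m.
  case/orP: pq => /transferP[x [y [_ xP _ e]]]; last by exists x; lia.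
  by exists y; rewrite e mnmDE mnm1E eqxx addn1.
have [k1 hk1] := hit_exists i qm.
have [k' [hk' c]] := IH _ _ qr sE hk1; exists k'; split => //.
apply: tconn_trans c; case/orP: pq => pq.
  exact: tconn_transfer_hit pq (lehmer_staircase _) hk hk1.
exact/tconn_sym/(tconn_transfer_hit pq (lehmer_staircase _) hk1 hk).
Qed.

(** * Comparison of the two graphs *)

(** All the monomials of a Schubert polynomial are connected. *)
Lemma schubert_tconn (w : 'S_N) a :
  a \in msupp (schubert w) -> tconn (lehmer w) a.
Proof.
elim/perm_ascent_ind: w a => [w na|w i j asc IH] a.
  rewrite schubert_noascent // msuppX inE => /eqP ->.
  exact/tconn_refl/lehmer_staircase.
move=> aw; have /staircaseP as_ := schubert_staircase aw; move: aw.
have ji := ascent_succ asc; have ij := ascent_neq asc.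
rewrite (schubert_ascent asc) => /(msupp_ddiff ij) [b [bv bk bij bi bj]].
have bs := schubert_staircase bv; have [vi vj vk] := lehmer_ascent asc.
set v := (tperm i j * w)%g in vi vj vk bv IH.
have /staircaseP bs' := bs; have /staircaseP ws := lehmer_staircase w.
have := bs' i; have := bs' j; have := ws j; have := ltn_ord j.
move=> jN wj bsj bsi.
have asc_le : lehmer w i <= lehmer w j by rewrite -is_ascent_lehmer.
have hv : hit i (lehmer v) i.
  by rewrite /hit vi; split => //; left; split => // l; lia.
have [k [[bk0 hk] c]] := tconn_hit (IH _ bv) hv.
(* The codes lehmer w, lehmer v - U_(i), b - U_(k) and a are connected in turn:
   the outer two steps take place on the line through the positions i and j. *)
apply: tconn_trans (_ : tconn _ (lehmer v - U_(i))%MM) _.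
  apply: (@tconn_line _ _ i j) => //.
  - exact: lehmer_staircase.
  - exact/staircaseB/lehmer_staircase.
  - move=> l li lj; rewrite mnmBE mnm1E eq_sym (negPf li) subn0.
    by rewrite vk.
  - by rewrite !mnmBE !mnm1E eqxx (negPf ij) vi vj; lia.
  - by lia.
  - by rewrite mnmBE mnm1E eqxx vi; lia.
apply: tconn_trans c _.
have val (x y : 'I_N) : x = y :> nat -> x = y by exact: val_inj.
have kE : k = i \/ k = j /\ b i = 0.
  case: hk => [[ik z]|[ki z]]; last by have := z i; have := z j; lia.
  case: (eqVneq k i) => [|ki]; first by left.
  have ik' : i < k by move: ki; rewrite -val_eqE /=; lia.
  have bi0 : b i = 0 by apply: z; lia.
  right; split => //; apply: val; apply/eqP; apply: contraT => ne.
  by have := z j; lia.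
apply: (@tconn_line _ _ i j) => //.
- exact: staircaseB.
- exact/staircaseP.
- move=> l li lj; rewrite mnmBE mnm1E bk //.
  by case: kE => [->|[-> _]]; rewrite eq_sym ?(negPf li) ?(negPf lj) subn0.
- rewrite !mnmBE !mnm1E; case: kE => [kE|[kE bi0]]; subst k.
    by rewrite eqxx (negPf ij); lia.
  by rewrite eqxx eq_sym (negPf ij); lia.
- rewrite mnmBE mnm1E; case: kE => [kE|[kE bi0]]; subst k; last by lia.
  by rewrite eqxx; lia.
- lia.
Qed.

(** The two ends c and d of a transfer from i to j = i + 1 both occur in the
    Schubert polynomial whose code moves as much as possible from i to j. *)
Lemma transfer_pieri (p s : 'S_N) :
  transfer (lehmer p) (lehmer s) -> connect (@pieri_graph N) p s.
Proof.
move=> /transferP[i [j [ji pi pj sE]]]; set c := lehmer p in pi pj sE.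
have ij : i != j by rewrite -val_eqE /= ji; lia.
have /staircaseP cs := lehmer_staircase p; have jN := ltn_ord j.
pose h := minn (c i + c j) (N - j.+1); pose l := c i + c j - h.
have [w wE] : exists w : 'S_N, lehmer w = set_pair c i j l h.
  apply: lehmer_surj; apply/staircaseP => k; rewrite mnmE.
  case: eqVneq => [->|ki]; first by rewrite /l /h; have := cs i; lia.
  by case: eqVneq => [->|kj]; [rewrite /h; lia | apply: cs].
have wi : lehmer w i = l by rewrite wE set_pairl.
have wj : lehmer w j = h by rewrite wE set_pairr.
have asc : is_ascent w (i, j) by rewrite is_ascent_lehmer // wi wj /l /h; lia.
have edge (v : 'S_N) : (forall k, k != i -> k != j -> lehmer v k = c k) ->
    l <= lehmer v i <= h -> lehmer v i + lehmer v j = c i + c j ->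
    connect (@pieri_graph N) v w.
  move=> vk vi vij; case: (eqVneq v w) => [->|vw]; first exact: connect0.
  apply: connect1; rewrite /pieri_graph vw; apply/orP; left.
  rewrite [X in mcoeff X _](@set_pair_eq _ (lehmer w) i j).
    by rewrite schubert_pair_eq1 ?schubert_lehmer // wi wj // /l /h; lia.
  by move=> k ki kj; rewrite wE set_pairN // vk.
have pieri_sym : connect_sym (@pieri_graph N).
  by apply: sym_connect_sym => x y; rewrite /pieri_graph eq_sym orbC.
apply: (@connect_trans _ _ w); last rewrite pieri_sym; apply: edge.
- by [].
- by rewrite -/c /l /h; have := cs i; lia.
- by [].
- by move=> k ki kj; rewrite sE mnmDE mnmBE !mnm1E eq_sym (negPf ki) eq_sym (negPf kj)
    subn0 addn0.
- rewrite sE mnmDE mnmBE !mnm1E eqxx [j == i]eq_sym (negPf ij) /l /h.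
  by have := cs i; lia.
- rewrite sE !mnmDE !mnmBE !mnm1E !eqxx [j == i]eq_sym (negPf ij).
  by lia.
Qed.

Lemma pieri_transfer (p s : 'S_N) :
  pieri_graph p s -> connect (@transfer_graph N) p s.
Proof.
have main (x y : 'S_N) : (0 < mcoeff (lehmer x) (schubert y))%R ->
    connect (@transfer_graph N) y x.
  move=> xy; have : lehmer x \in msupp (schubert y).
    by rewrite mcoeff_msupp; apply: contraTneq xy => ->; rewrite Order.POrderTheory.ltxx.
  by move=> /schubert_tconn [p' [s' [/lehmer_inj -> /lehmer_inj -> ]]].
by case/andP=> _ /orP[] /main //; rewrite transfer_connect_sym.
Qed.

Lemma connect_pieri_transfer (p s : 'S_N) :
  connect (@pieri_graph N) p s = connect (@transfer_graph N) p s.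
Proof.
have pieri_sym : connect_sym (@pieri_graph N).
  by apply: sym_connect_sym => x y; rewrite /pieri_graph eq_sym orbC.
apply/idP/idP; apply: connect_sub => x y; first exact: pieri_transfer.
by case/orP=> /transfer_pieri //; rewrite pieri_sym.
Qed.

End Tconn.

Theorem proposition14p3 (N : nat) :
  components (@pieri_graph N) = components (@transfer_graph N).
Proof.
apply: eq_imset => p; apply/setP => s.
by rewrite !inE connect_pieri_transfer.
Qed.
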